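(* Every graph $H$ with minimum degree $\delta(H)\ge 4$ is a hideout graph.
   Context: The robber-locating game on a finite connected simple graph $G$: a robber occupies an unknown vertex. In each round the cop probes any vertex $p$ of $G$ (no restriction), and the robber truthfully announces the graph distance from his current vertex to $p$. If the information gathered so far determines the robber's current vertex uniquely, the cop wins. Otherwise the robber moves to an adjacent vertex or stays put, with the no-backtrack condition: he may not move to the vertex $p$ just probed. The robber is omniscient. $G$ is locatable if the cop has a strategy guaranteed to determine the robber's vertex after finitely many probes, and non-locatable otherwise. A graph $H$ is a hideout graph if every (connected) graph containing a (not necessarily induced) subgraph isomorphic to $H$ is non-locatable. *)

(* Defs.v *)
From mathcomp Require Import all_boot.

Set Implicit Arguments.
Unset Strict Implicit.
Unset Printing Implicit Defensive.

Record sgraph := SGraph {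
  vertex :> finType;
  adj : rel vertex;
  adj_sym : symmetric adj;
  adj_irrefl : irreflexive adj
}.

Section Graphs.
Variable G : sgraph.

Definition degree (x : G) : nat := #|[set y : G | adj x y]|.

(* Every degree is below #|G|, so for nonempty G the default value does not
   affect the minimum; it gives the empty graph minimum degree 0. *)
Definition min_degree : nat := \big[minn/#|G|]_(x : G) degree x.

Definition connected : Prop :=
  0 < #|G| /\ forall x y : G, connect (@adj G) x y.

Definition walk_of_length (x y : G) (k : nat) : bool :=
  [exists p : k.-tuple G, path (@adj G) x p && (last x p == y)].

(* The least length of a walk from x to y: [find] returns the index of the
   first k in 0, ..., #|G|-1 that works, and a shortest path has fewer than
   #|G| edges.  The junk value for disconnected pairs is #|G|. *)
Definition dist (x y : G) : nat :=
  find (walk_of_length x y) (iota 0 #|G|).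

(* A strategy maps the list of answers received so far (oldest first) to the
   next probe; earlier probes are determined by the strategy and the answers. *)
Definition strategy := seq nat -> G.

(* A trajectory x : nat -> G gives the robber's position x n at the time of
   the n-th probe, counting from 0. *)
Section Play.
Variable s : strategy.
Implicit Types x y : nat -> G.

(* answers to probes 0, ..., n-1 *)
Fixpoint answers x (n : nat) : seq nat :=
  if n is m.+1 then rcons (answers x m) (dist (x m) (s (answers x m)))
  else [::].

Definition probe x (n : nat) : G := s (answers x n).

Definition legal_move x (n : nat) : Prop :=
  (x n.+1 = x n \/ adj (x n) (x n.+1)) /\ x n.+1 <> probe x n.

(* The answers to probes 0, ..., n determine the position x n: it is the only
   possible current position of a robber obeying the rules and giving the same
   answers. *)
Definition located x (n : nat) : Prop :=
  forall y, (forall i, i < n -> legal_move y i) ->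
    answers y n.+1 = answers x n.+1 -> y n = x n.

(* The rules bind the robber only until he is located: the values of x after
   the end of the game are irrelevant. *)
Definition winning : Prop :=
  forall x, (forall n, ~ located x n -> legal_move x n) ->
    exists n, located x n.

End Play.

Definition locatable : Prop := exists s : strategy, winning s.

End Graphs.

(* G contains a, not necessarily induced, subgraph isomorphic to H. *)
Definition contains_copy (G H : sgraph) : Prop :=
  exists f : H -> G, injective f /\ forall x y, adj x y -> adj (f x) (f y).

Definition hideout (H : sgraph) : Prop :=
  forall G : sgraph, connected G -> contains_copy G H -> ~ locatable G.

(* Main.v *)
(** A closed neighbourhood in [H] has at least five vertices, hence at least
    four besides the vertex just probed, and their distances to the next probe
    take at most three values.  So two possible moves of the robber always get
    the same answer; he makes one of them and the other one keeps him hidden. *)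
Require Import Defs.
From mathcomp Require Import all_boot.

Set Implicit Arguments.
Unset Strict Implicit.
Unset Printing Implicit Defensive.

Lemma geq_bigminn_seq (I : eqType) (r : seq I) (F : I -> nat) m i :
  i \in r -> \big[minn/m]_(j <- r) F j <= F i.
Proof.
elim: r => // j r IHr; rewrite inE big_cons geq_min.
by case/predU1P => [-> | /IHr ->]; rewrite ?leqnn ?orbT.
Qed.

Lemma min_degree_leq (G : sgraph) (x : G) : min_degree G <= degree x.
Proof. exact/geq_bigminn_seq/mem_index_enum. Qed.

Lemma min_degree_leq_card (G : sgraph) : min_degree G <= #|G|.
Proof.
by rewrite /min_degree; elim/big_rec: _ => // i m _; rewrite geq_min orbC => ->.
Qed.

Lemma dist_leq_walk (G : sgraph) (x y : G) k :
  walk_of_length x y k -> dist x y <= k.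
Proof.
move=> walk_k; rewrite leqNgt; apply/negP => lt_k; move: (before_find 0 lt_k).
have lt_kG : k < #|G|.
  by rewrite (leq_trans lt_k) // -[leqRHS](size_iota 0) find_size.
by rewrite nth_iota // add0n walk_k.
Qed.

Lemma dist_adj (G : sgraph) (x y z : G) : adj x y -> dist x z <= (dist y z).+1.
Proof.
move=> xy; have le_dist : dist x z <= #|G|.
  by rewrite -[leqRHS](size_iota 0) find_size.
(* When [dist y z] is the junk value [#|G|], the bound holds because no distance exceeds [#|G|];
   otherwise a walk from [y] is prolonged by the edge. *)
have [lt_dist | /leqW] := ltnP (dist y z) #|G|; last exact: leq_trans.
have : walk_of_length y z (dist y z).
  rewrite -[X in walk_of_length _ _ X]add0n -(nth_iota 0 0 lt_dist).
  by apply: nth_find; rewrite has_find size_iota.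
case/existsP => p /andP [path_p last_p]; apply: dist_leq_walk.
by apply/existsP; exists [tuple of y :: p]; rewrite /= xy path_p.
Qed.

Section Evasion.
Variables (G H : sgraph) (f : H -> G).
Hypothesis f_inj : injective f.
Hypothesis f_adj : forall x y, adj x y -> adj (f x) (f y).
Hypothesis H_deg : 4 <= min_degree H.

Definition moves (a : H) (p : G) : {set H} :=
  [set b in a |: [set b | adj a b] | f b != p].

Lemma moves_card a p : 3 < #|moves a p|.
Proof.
set N := a |: [set b | adj a b].
have N_card : 4 < #|N|.
  by rewrite cardsU1 inE adj_irrefl ltnS (leq_trans H_deg) ?min_degree_leq.
(* By injectivity of [f], the probed vertex excludes at most one element of [N]. *)
have le1 : #|N :\: moves a p| <= 1.
  apply/card_le1_eqP => b c; rewrite !inE.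
  case/andP => nb Nb /andP [nc Nc]; apply: f_inj.
  by move: nb nc; rewrite Nb Nc /= !negbK => /eqP -> /eqP ->.
have MN : moves a p \subset N by apply/subsetP => b; rewrite inE => /andP [].
have := cardsID (moves a p) N; rewrite (setIidPr MN) => N_split.
by rewrite -ltnS (leq_trans N_card) // -N_split -addn1 leq_add2l.
Qed.

Lemma moves_dist a p q b : b \in moves a p ->
  dist (f b) q <= (dist (f a) q).+1 /\ dist (f a) q <= (dist (f b) q).+1.
Proof.
rewrite !inE => /andP [/predU1P [-> | ab] _]; first by rewrite leqnSn.
by split; apply: dist_adj; apply: f_adj; rewrite // adj_sym.
Qed.

Definition confusable a p q b c :=
  [&& b \in moves a p, c \in moves a p, c != b & dist (f c) q == dist (f b) q].

Lemma confusable_exists a p q : exists b, [exists c, confusable a p q b c].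
Proof.
(* The shift by one sends the possible distances d-1, d, d+1, with d the distance from [f a], to 0,
   1, 2, so the subtraction never truncates on moves. *)
pose g b : 'I_3 := inord ((dist (f b) q).+1 - dist (f a) q).
have /dinjectivePn [b Mb [c /andP [nbc Mc] g_eq]] :
    ~~ dinjectiveb g (moves a p).
  apply/negP => /dinjectiveP /leq_card_in.
  by rewrite card_ord leqNgt moves_card.
exists b; apply/existsP; exists c; rewrite /confusable Mb Mc nbc /=.
have [b1 b2] := moves_dist q Mb; have [c1 c2] := moves_dist q Mc.
have/(congr1 val) := g_eq; rewrite /= !inordK ?ltnS ?leq_subLR ?addn2 //.
by move/(congr1 (addn (dist (f a) q))); rewrite !subnKC // => - [->].
Qed.

(** The choice may depend on the next probe [q]: the strategy is deterministic, so the answer at [a]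
    already fixes it. *)
Definition evade a p q : H := xchoose (confusable_exists a p q).

Lemma evadeP a p q : exists c, confusable a p q (evade a p q) c.
Proof. exact/existsP/(xchooseP (confusable_exists a p q)). Qed.

Variables (s : strategy G) (a0 : H).

(* The position at the n-th probe and the answers received before it.  At
   time 0 nothing has been probed yet; avoiding [f a0] there is harmless. *)
Fixpoint evasion n : H * seq nat :=
  if n is m.+1 then
    let: (a, h) := evasion m in
    let h' := rcons h (dist (f a) (s h)) in (evade a (s h) (s h'), h')
  else (evade a0 (f a0) (s [::]), [::]).

Definition evader n : G := f (evasion n).1.

Lemma answers_evader n : answers s evader n = (evasion n).2.
Proof. by elim: n => //= n ->; rewrite /evader; case: evasion. Qed.

Lemma evasionS n : (evasion n.+1).1 =
  evade (evasion n).1 (probe s evader n) (probe s evader n.+1).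
Proof.
by rewrite /probe /= !answers_evader /evader; case: evasion.
Qed.

(** Stated for any trajectory, as it serves both the evader and the last move of the decoy in
    [evader_not_located]. *)
Lemma moves_legal (x : nat -> G) n a b : x n = f a -> x n.+1 = f b ->
  b \in moves a (probe s x n) -> legal_move s x n.
Proof.
move=> xn xSn; rewrite !inE /legal_move xn xSn => /andP [ab /eqP bp].
by split=> //; case/predU1P: ab => [-> | /f_adj]; [left | right].
Qed.

Lemma evader_legal n : legal_move s evader n.
Proof.
apply: (moves_legal (erefl _) (erefl _)); rewrite evasionS.
by have [c /and4P []] :=
  evadeP (evasion n).1 (probe s evader n) (probe s evader n.+1).
Qed.

Lemma answers_eq (x y : nat -> G) n :
  (forall i, i < n -> x i = y i) -> answers s x n = answers s y n.
Proof.
elim: n => //= n IHn xy; rewrite xy // IHn // => i lt_in.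
exact/xy/leqW.
Qed.

Lemma evader_not_located n : ~ located s evader n.
Proof.
have [c [c_legal c_neq c_dist]] : exists c : H,
    [/\ forall m, n = m.+1 -> c \in moves (evasion m).1 (probe s evader m),
        f c != evader n
      & dist (f c) (probe s evader n) = dist (evader n) (probe s evader n)].
  (* At time 0 no move leads to the decoy vertex, so only its distance matters. *)
  case: n => [|n].
    have [c /and4P [_ _ cb /eqP c_dist]] := evadeP a0 (f a0) (s [::]).
    by exists c; rewrite (inj_eq f_inj).
  have [c /and4P [_ Mc cb /eqP c_dist]] :=
    evadeP (evasion n).1 (probe s evader n) (probe s evader n.+1).
  exists c; rewrite /(evader n.+1) evasionS (inj_eq f_inj).
  by split=> // m [<-].
(* The decoy leaves the evader's trajectory at time [n] only; [located] never looks at later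
   positions. *)
pose y i := if i == n then f c else evader i.
have y_lt i : i < n -> y i = evader i by rewrite /y; case: ltngtP.
have yn : y n = f c by rewrite /y eqxx.
have y_ans i : i <= n -> answers s y i = answers s evader i.
  move=> le_in; apply: answers_eq => j lt_ji.
  by rewrite y_lt // (leq_trans lt_ji).
move/(_ y) => loc; case/eqP: c_neq; rewrite -yn.
apply: loc => [i lt_in|]; last first.
  by rewrite /= y_ans // yn c_dist.
have y_probe : probe s y i = probe s evader i by rewrite /probe y_ans // ltnW.
have [Sin | neq_Sin] := eqVneq i.+1 n.
  apply: (@moves_legal y i (evasion i).1 c); [exact: y_lt | by rewrite Sin |].
  by rewrite y_probe c_legal.
have lt_Sin : i.+1 < n by rewrite ltn_neqAle neq_Sin.
by rewrite /legal_move y_probe !y_lt //; exact: evader_legal.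
Qed.

End Evasion.

Theorem theorem4p3 (H : sgraph) (hdelta : 4 <= min_degree H) : hideout H.
Proof.
move=> G _ [f [f_inj f_adj]] [s win].
(* The default value [#|H|] in the minimum rules out an empty [H]. *)
have /card_gt0P [a0 _] : 0 < #|H|.
  exact: leq_trans (leq_trans hdelta (min_degree_leq_card H)).
have [n _ | n] := win (evader f_inj f_adj hdelta s a0).
  exact: evader_legal.
exact: evader_not_located.
Qed.
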